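(* Let $n$ be a positive integer. If $(T_1,\ldots,T_n)\in B(\mathcal H)^{(n)}$, then $$w_e(T_1,\ldots,T_n)\le w(T_1,\ldots,T_n)$$ and $$\frac1{2\sqrt n}\|[T_1,\ldots,T_n]\|\le w_e(T_1,\ldots,T_n)\le\|[T_1,\ldots,T_n]\|.$$ Moreover, the inequalities are sharp, i.e. the constants $1$, $\frac1{2\sqrt n}$ and $1$ in these inequalities (over all Hilbert spaces and all $n$-tuples) cannot be improved.
   Context: $\mathcal H$ is a complex Hilbert space. $\|[T_1,\ldots,T_n]\|=\left\|\sum_{i=1}^nT_iT_i^*\right\|^{1/2}$ is the norm of the row operator. Euclidean operator radius: $w_e(T_1,\ldots,T_n):=\sup_{\|h\|=1}\left(\sum_{i=1}^n|\langle T_ih,h\rangle|^2\right)^{1/2}$. Joint numerical radius: $w(T_1,\ldots,T_n):=\sup\left|\sum_{\alpha\in\mathbb F_n^+}\sum_{j=1}^n\langle h_\alpha,T_jh_{g_j\alpha}\rangle\right|$, the supremum over all families $\{h_\alpha\}_{\alpha\in\mathbb F_n^+}\subset\mathcal H$ with $\sum_\alpha\|h_\alpha\|^2=1$, where $\mathbb F_n^+$ is the unital free semigroup on generators $g_1,\ldots,g_n$. *)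

(* Defs.v *)
From HB Require Import structures.
From mathcomp Require Import all_boot all_order all_algebra.
From mathcomp Require Import sesquilinear complex.
From mathcomp Require Import all_classical all_reals all_analysis.
From mathcomp.analysis.showcase Require summability.
Import Order.TTheory GRing.Theory Num.Theory Num.Def.
Import numFieldNormedType.Exports.

Set Implicit Arguments.
Unset Strict Implicit.
Unset Printing Implicit Defensive.

Local Open Scope classical_set_scope.
Local Open Scope ring_scope.
Local Open Scope complex_scope.

(* The dot products of sesquilinear.v are linear in the first argument and
   conjugate-linear in the second one. *)
HB.mixin Record CompleteNormedModule_isHilbert (R : realType) (H : Type)
    & CompleteNormedModule R[i] H := {
  inner : {dot H for (@conjC R[i])} ;
  sqr_normE : forall x : H, `|x| ^+ 2 = inner x x
}.

#[short(type="hilbertType")]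
HB.structure Definition Hilbert (R : realType) :=
  { H of CompleteNormedModule R[i] H & CompleteNormedModule_isHilbert R H }.

(* The norm of a normed module over R[i] (and the modulus of a complex number)
   is an element of R[i] with zero imaginary part; suprema live in R. *)
Definition rnorm (R : realType) (V : normedZmodType R[i]) (x : V) : R :=
  complex.Re `|x|.

Section operators.
Variables (R : realType) (H : hilbertType R).

Definition bounded_operator (T : {linear H -> H}) : Prop :=
  exists M : R, forall x, rnorm (T x) <= M * rnorm x.

Definition opnorm (T : H -> H) : R :=
  sup [set rnorm (T x) | x in [set x | rnorm x <= 1]].

(* For T linear and bounded, the vector z below exists by the Riesz
   representation theorem and is unique. *)
Definition adjoint (T : H -> H) (y : H) : H :=
  xget 0 [set z | forall x, inner (T x) y = inner x z].

Variables (n : nat) (T : 'I_n -> {linear H -> H}).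

Definition row_norm : R :=
  Num.sqrt (opnorm (fun x => \sum_(i < n) T i (adjoint (T i) x))).

Definition euclidean_radius : R :=
  sup [set Num.sqrt (\sum_(i < n) rnorm (inner (T i h) h) ^+ 2)
      | h in [set h | rnorm h = 1]].

(* The free semigroup on n generators is the type of words seq 'I_n, with
   [::] as unit and g_j a = j :: a.  summability.sum is the limit of the finite
   partial sums along the directed set of finite subsets; for T bounded and
   h square-summable, the family below is absolutely summable. *)
Definition joint_form (h : seq 'I_n -> H) : R[i] :=
  summability.sum
    (fun a => \sum_(j < n) inner (h a) (T j (h (j :: a))) : R[i]^o).

Definition joint_radius : R :=
  sup [set rnorm (joint_form h) | h in
    [set h : seq 'I_n -> H |
      (\esum_(a in [set: seq 'I_n]) (rnorm (h a) ^+ 2)%:E = 1)%E]].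

End operators.

(* Main.v *)
(*
  The inequality w_e <= w is tested on h_a = (N+1)^(-1/2) lambda_a h for words
  a of length at most N, where lambda_a is the product of the
  lambda_j = <h, T_j h> / r over the letters of a and
  r = (sum_i |<T_i h, h>|^2)^(1/2): words of each fixed length carry total
  weight 1/(N+1), and the form takes the value N/(N+1) r.  For w_e <= ||[T]||,
  write <T_i h, h> = <h, T_i^* h> and apply Cauchy-Schwarz; the adjoints exist
  by the Riesz representation theorem.  For the lower bound, polarization gives
  ||T_i|| <= 2 w_e, hence ||sum_i T_i T_i^*|| <= 4 n w_e^2.

  Sharpness is witnessed on C^(n+1): by the tuple (1, 0, ..., 0) for the two
  constants 1, and by T_i x = x_i e_0 (i = 1, ..., n) for 1/(2 sqrt n), where
  w_e = 1/2 and sum_i T_i T_i^* is n times the projection on e_0.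
*)
Require Import Defs.
From HB Require Import structures.
From mathcomp Require Import all_boot all_order all_algebra finmap.
From mathcomp Require Import sesquilinear complex ring lra.
From mathcomp Require Import all_classical all_reals all_analysis.
From mathcomp.analysis.showcase Require summability.
Set Implicit Arguments.
Unset Strict Implicit.
Unset Printing Implicit Defensive.
Import Order.TTheory GRing.Theory Num.Theory.
Import numFieldNormedType.Exports.
Local Open Scope classical_set_scope.
Local Open Scope ring_scope.
Local Open Scope complex_scope.

(** * Norms and inner products *)

Section Norm.
Context {R : realType} {V : normedZmodType R[i]}.
Implicit Types x y : V.

Lemma rnormE x : (rnorm x)%:C = `|x|.
Proof. by rewrite /rnorm RRe_real// ger0_real. Qed.

Lemma rnorm_ge0 x : 0 <= rnorm x.
Proof. by rewrite -ler0c rnormE. Qed.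

Lemma rnormD x y : rnorm (x + y) <= rnorm x + rnorm y.
Proof. by rewrite -lecR rmorphD /= !rnormE ler_normD. Qed.

Lemma rnorm0 : rnorm (0 : V) = 0.
Proof. by rewrite /rnorm normr0. Qed.

Lemma rnorm_eq0 x : rnorm x = 0 -> x = 0.
Proof. by move=> x0; apply/eqP; rewrite -normr_eq0 -rnormE x0. Qed.

Lemma rnorm_gt0 x : (0 < rnorm x) = (x != 0).
Proof. by rewrite -normr_gt0 -rnormE ltcR. Qed.

Lemma rnormN x : rnorm (- x) = rnorm x.
Proof. by rewrite /rnorm normrN. Qed.

Lemma rnorm_sum (I : Type) (r : seq I) (P : pred I) (F : I -> V) :
  rnorm (\sum_(i <- r | P i) F i) <= \sum_(i <- r | P i) rnorm (F i).
Proof.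
elim/big_rec2 : _ => [|i y x _ xy]; first by rewrite rnorm0.
by rewrite (le_trans (rnormD _ _))// lerD2l.
Qed.

End Norm.

Section Modulus.
Context {R : realType}.
Implicit Types x y : R[i].

Lemma rnormM x y : rnorm (x * y) = rnorm x * rnorm y.
Proof. by apply: complexI; rewrite rmorphM /= !rnormE normrM. Qed.

Lemma rnormJ x : rnorm (Num.conj x) = rnorm x.
Proof. by rewrite /rnorm norm_conjC. Qed.

Lemma rnorm_real (a : R) : rnorm a%:C = `|a|.
Proof. by apply: complexI; rewrite rnormE normc_def /= expr0n addr0 sqrtr_sqr. Qed.

Lemma ler_Re_rnorm x : complex.Re x <= rnorm x.
Proof.
by rewrite (le_trans (ler_norm _))// -lecR rnormE normc_ge_Re.
Qed.

Lemma sqr_rnormC x : (rnorm x ^+ 2)%:C = x * Num.conj x.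
Proof. by rewrite rmorphXn /= rnormE normCK. Qed.

Lemma sqr_rnormE x : rnorm x ^+ 2 = complex.Re x ^+ 2 + complex.Im x ^+ 2.
Proof. by apply: complexI; rewrite rmorphXn /= rnormE -add_Re2_Im2. Qed.

Lemma ReD x y : complex.Re (x + y) = complex.Re x + complex.Re y.
Proof. by case: x y => [? ?] []. Qed.

Lemma ReN x : complex.Re (- x) = - complex.Re x.
Proof. by case: x. Qed.

Lemma ImD x y : complex.Im (x + y) = complex.Im x + complex.Im y.
Proof. by case: x y => [? ?] []. Qed.

Lemma ImN x : complex.Im (- x) = - complex.Im x.
Proof. by case: x. Qed.

Lemma ler_normIm x : `|complex.Im x| <= rnorm x.
Proof.
rewrite -(@ler_pXn2r _ 2) ?nnegrE ?rnorm_ge0// sqr_rnormE real_normK ?num_real//.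
by rewrite lerDr sqr_ge0.
Qed.

Lemma ReZ (a : R) x : complex.Re (a%:C * x) = a * complex.Re x.
Proof. by case: x => u v /=; rewrite mul0r subr0. Qed.

Lemma conj_realC (a : R) : Num.conj a%:C = a%:C.
Proof. exact: conjc_real. Qed.

Lemma Re_conj x : complex.Re (Num.conj x) = complex.Re x.
Proof. by case: x. Qed.

End Modulus.

Section HilbertNorm.
Context {R : realType} {H : hilbertType R}.
Implicit Types (x y : H) (a : R[i]).

Lemma innerC x y : inner x y = Num.conj (inner y x).
Proof. by rewrite hermC mul1r. Qed.

Lemma innerDl x y z : inner (x + y) z = inner x z + inner y z.
Proof. exact: linearDl. Qed.

Lemma innerDr x y z : inner x (y + z) = inner x y + inner x z.
Proof. exact: linearDr. Qed.

Lemma innerNr x y : inner x (- y) = - inner x y.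
Proof. exact: linearNr. Qed.

Lemma innerZl a x y : inner (a *: x) y = a * inner x y.
Proof. exact: linearZl_LR. Qed.

Lemma innerZr a x y : inner x (a *: y) = Num.conj a * inner x y.
Proof. exact: linearZr_LR. Qed.

Lemma Re_innerC x y : complex.Re (inner x y) = complex.Re (inner y x).
Proof. by rewrite innerC Re_conj. Qed.

Lemma Re_innerZr (s : R) x y :
  complex.Re (inner x (s%:C *: y)) = s * complex.Re (inner x y).
Proof. by rewrite Re_innerC innerZl ReZ Re_innerC. Qed.

Lemma sqr_rnorm_inner x : (rnorm x ^+ 2)%:C = inner x x.
Proof. by rewrite rmorphXn /= rnormE sqr_normE. Qed.

Lemma sqr_rnorm x : rnorm x ^+ 2 = complex.Re (inner x x).
Proof. by rewrite -sqr_rnorm_inner. Qed.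

Lemma rnormZ a x : rnorm (a *: x) = rnorm a * rnorm x.
Proof. by apply: complexI; rewrite rmorphM /= !rnormE normrZ. Qed.

Lemma sqr_rnormD x y :
  rnorm (x + y) ^+ 2 = rnorm x ^+ 2 + rnorm y ^+ 2 + 2 * complex.Re (inner x y).
Proof.
rewrite !sqr_rnorm innerDl !innerDr (innerC y x) !ReD Re_conj; ring.
Qed.

Lemma sqr_rnormB x y :
  rnorm (x - y) ^+ 2 = rnorm x ^+ 2 + rnorm y ^+ 2 - 2 * complex.Re (inner x y).
Proof. by rewrite sqr_rnormD rnormN innerNr ReN mulrN. Qed.

(** Expanding [0 <= |(|y|^2 x - <x,y> y)|^2] gives [|y|^2 (|x|^2 |y|^2 - |<x,y>|^2) >= 0]; scaling
    by [|y|^2] instead of projecting avoids a division. *)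
Lemma cauchy_schwarz x y : rnorm (inner x y) <= rnorm x * rnorm y.
Proof.
have [->|y0] := eqVneq y 0; first by rewrite linear0r !rnorm0 mulr0.
have ny0 : 0 < rnorm y by rewrite rnorm_gt0.
set d := inner x y.
have := sqr_ge0 (rnorm ((rnorm y ^+ 2)%:C *: x - d *: y)).
rewrite sqr_rnormB innerZl ReZ innerZr !rnormZ -/d rnorm_real ger0_norm ?sqr_ge0//.
rewrite mulrC [Num.conj d * d]mulrC -sqr_rnormC /= => h.
have {h} : 0 <= rnorm y ^+ 2 * ((rnorm x * rnorm y) ^+ 2 - rnorm d ^+ 2).
  by apply: le_trans h _; rewrite le_eqVlt; apply/orP; left; apply/eqP; ring.
rewrite pmulr_rge0 ?exprn_gt0// subr_ge0 ler_pXn2r ?nnegrE ?mulr_ge0 ?rnorm_ge0//.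
Qed.

End HilbertNorm.

(** * Riesz representation *)

Section Riesz.
Context {R : realType} {H : hilbertType R}.
Variables (f : H -> R[i]) (K : R).
Hypothesis f_additive : forall x y, f (x + y) = f x + f y.
Hypothesis f_scalable : forall a x, f (a *: x) = a * f x.
Hypothesis f_bounded : forall x, rnorm (f x) <= K * rnorm x.

(* The vector representing f is the minimizer of J. *)
Let J (x : H) : R := rnorm x ^+ 2 - 2 * complex.Re (f x).

Let Re_f_le x : complex.Re (f x) <= `|K| * rnorm x.
Proof.
apply: le_trans (ler_Re_rnorm _) _; apply: le_trans (f_bounded _) _.
by rewrite ler_wpM2r ?rnorm_ge0// ler_norm.
Qed.

Let J_lb : has_lbound (range J).
Proof.
exists (- `|K| ^+ 2) => _ [x _ <-]; rewrite /J.
(* [J x >= |x|^2 - 2 |K| |x| = (|x| - |K|)^2 - |K|^2]. The modulus of [K] appears because no sign is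
   assumed. *)
have := Re_f_le x; have := sqr_ge0 (rnorm x - `|K|); lra.
Qed.

Let m := inf (range J).

Let J_ge x : m <= J x.
Proof. by apply: ge_inf => //; exists x. Qed.

(** By the parallelogram law [J x + J y - 2 J ((x + y) / 2) = |x - y|^2 / 2], the linear parts
    cancelling; so minimizing sequences are Cauchy. *)
Let J_mid x y : rnorm (x - y) ^+ 2 <= 2 * (J x - m) + 2 * (J y - m).
Proof.
have := J_ge ((2^-1)%:C *: (x + y)).
rewrite /J rnormZ rnorm_real ger0_norm ?invr_ge0// f_scalable ReZ f_additive ReD.
rewrite exprMn sqr_rnormD sqr_rnormB; lra.
Qed.

(** One-sided continuity of [J] at [z], used to pass to the limit along a minimizing sequence. Near
    [z], [|z| + |x| <= 2 |z| + 1] controls the difference of squares. *)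
Let J_lip z x : rnorm (z - x) <= 1 ->
  J z <= J x + rnorm (z - x) * (2 * rnorm z + 1 + 2 * `|K|).
Proof.
move=> zx1; have := Re_f_le (x - z).
have -> : f (x - z) = f x - f z by rewrite f_additive -scaleN1r f_scalable mulN1r.
rewrite ReD ReN; have -> : rnorm (x - z) = rnorm (z - x) by rewrite -rnormN opprB.
have : rnorm x <= rnorm z + rnorm (z - x).
  by rewrite -[rnorm (z - x)]rnormN opprB -[X in rnorm X <= _](subrKC z x) rnormD.
have : rnorm z <= rnorm x + rnorm (z - x).
  by rewrite -[X in rnorm X <= _](subrKC x z) rnormD.
have := rnorm_ge0 (z - x); have := rnorm_ge0 z; have := rnorm_ge0 x.
move: zx1; rewrite /J; nra.
Qed.

Let minimizer : exists z, J z <= m.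
Proof.
have near_inf (k : nat) : exists x, J x < m + k.+1%:R^-1.
  have J_inf : has_inf (range J) by split; [exists (J 0); exists 0|exact: J_lb].
  have k0 : 0 < k.+1%:R^-1 :> R by rewrite invr_gt0.
  by have [_ [x _ <-] xm] := inf_adherent k0 J_inf; exists x.
have [u um] := choice near_inf.
have cu : cauchy (u @ \oo).
  apply/cauchy_ballP => e e0; rewrite -ball_normE.
  (* Radii of balls live in [R[i]]; a positive one is real. *)
  have [eR e0'] : e = (complex.Re e)%:C /\ 0 < complex.Re e.
    by have := gtr0_real e0 => /RRe_real eE; rewrite -ltcR eE.
  set d := complex.Re e in eR e0'.
  (* With both excesses below [d^2 / 4], [J_mid] yields [|u x - u y|^2 < d^2]. *)
  have d4 : 0 < d ^+ 2 / 4 by rewrite divr_gt0 ?exprn_gt0.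
  have near_u : \forall k \near \oo, J (u k) - m < d ^+ 2 / 4.
    near=> k; rewrite ltrBlDl; apply: lt_trans (um k) _; rewrite ltrD2l.
    by near: k; exact: near_infty_natSinv_lt (PosNum d4).
  rewrite near_map2.
  near=> x y.
  have Jx : J (u x) - m < d ^+ 2 / 4 by near: x.
  have Jy : J (u y) - m < d ^+ 2 / 4 by near: y.
  rewrite /= eR -rnormE ltcR -(@ltr_pXn2r _ 2)// ?nnegrE ?rnorm_ge0 ?ltW//.
  have := J_mid (u x) (u y); lra.
have /cvg_ex[z uz] : cvg (u @ \oo) by exact: cauchy_cvg.
exists z; apply/ler_addgt0Pr => e e0.
set C := 2 * rnorm z + 1 + 2 * `|K|.
have C0 : 0 < C.
  by have := rnorm_ge0 z; have := normr_ge0 K; rewrite /C; lra.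
(* The error [e] is split between the excess of [J (u k)] over [m] and the Lipschitz term, each at
   most [e / 2]. *)
have [k [uk zk1 zkC]] : exists k, [/\ J (u k) < m + e / 2, rnorm (z - u k) <= 1
    & rnorm (z - u k) <= e / 2 / C].
  near \oo => k; exists k; split.
  - apply: lt_trans (um k) _; rewrite ltrD2l.
    near: k; have e2 : 0 < e / 2 by rewrite divr_gt0.
    exact: near_infty_natSinv_lt (PosNum e2).
  - rewrite -lecR rnormE; near: k.
    by move/cvgrPdist_le : uz; apply; rewrite ltcR.
  - rewrite -lecR rnormE; near: k.
    by move/cvgrPdist_le : uz; apply; rewrite ltcR !divr_gt0.
have := J_lip zk1; rewrite -/C.
by move: zkC; rewrite ler_pdivlMr//; lra.
Unshelve. all: by end_near. Qed.

Lemma riesz : exists z, forall x, f x = inner x z.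
Proof.
have [z zm] := minimizer; exists z.
have Re_eq x : complex.Re (inner x z) = complex.Re (f x).
  set g := complex.Re (inner x z) - complex.Re (f x).
  (* This is [J (z + s x) - J z], nonnegative because [z] is a minimizer. *)
  have variation (s : R) : 0 <= s ^+ 2 * rnorm x ^+ 2 + 2 * s * g.
    have := le_trans zm (J_ge (z + s%:C *: x)).
    rewrite /J sqr_rnormD f_additive f_scalable ReD ReZ Re_innerZr Re_innerC.
    by rewrite rnormZ rnorm_real exprMn real_normK ?num_real// /g; lra.
  have q0 : 0 < rnorm x ^+ 2 + 1 by rewrite ltr_wpDl ?sqr_ge0.
  (* The denominator [|x|^2 + 1] also serves for [x = 0]; the variation becomes a negative multiple
     of [g^2], which forces [g = 0]. *)
  have := variation (- g / (rnorm x ^+ 2 + 1)).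
  set q := rnorm x ^+ 2 in q0 *.
  have -> : (- g / (q + 1)) ^+ 2 * q + 2 * (- g / (q + 1)) * g
     = - (g ^+ 2 * ((q + 2) / (q + 1) ^+ 2)) by field; rewrite gt_eqF.
  rewrite oppr_ge0 pmulr_lle0; last by rewrite divr_gt0 ?exprn_gt0//; lra.
  by move=> g2; apply/eqP; rewrite -subr_eq0 -/g -sqrf_eq0 eq_le g2 sqr_ge0.
(* A complex-linear functional is determined by its real part: the value at [i x] gives the
   imaginary part at [x]. *)
move=> x; have := Re_eq x; have := Re_eq ('i *: x).
rewrite innerZl f_scalable; case: (f x) (inner x z) => [a b] [c d] /=.
rewrite !mul0r !mul1r !sub0r => /oppr_inj -> ->//.
Qed.

End Riesz.

(** * Operators and the Euclidean radius *)

Section Operators.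
Context {R : realType} {H : hilbertType R}.
Implicit Types (S : H -> H) (x y z : H).

Lemma inner_injr z z' : (forall x, inner x z = inner x z') -> z = z'.
Proof.
move=> zz'; apply/eqP; rewrite -subr_eq0; apply/eqP/rnorm_eq0/eqP.
by rewrite -sqrf_eq0 sqr_rnorm innerDr innerNr zz' subrr.
Qed.

(** At most one vector represents the functional, so the choice made by [xget] must return it. *)
Lemma adjoint_eq S y z : (forall x, inner (S x) y = inner x z) -> adjoint S y = z.
Proof.
move=> Syz; apply: xget_subset1 => // u v /= Su Sv.
by apply: inner_injr => x; rewrite -Su -Sv.
Qed.

Lemma inner_adjoint (S : {linear H -> H}) (M : R) :
  (forall x, rnorm (S x) <= M * rnorm x) ->
  forall x y, inner (S x) y = inner x (adjoint S y).
Proof.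
move=> S_le x y.
have [||u|z Sz] := @riesz _ H (fun x => inner (S x) y) (M * rnorm y).
- by move=> u v; rewrite linearD innerDl.
- by move=> a u; rewrite linearZ innerZl.
- by rewrite mulrAC (le_trans (cauchy_schwarz _ _))// ler_wpM2r ?rnorm_ge0.
by rewrite (adjoint_eq Sz).
Qed.

(** [|S* y|^2 = <S S* y, y> <= M |S* y| |y|], then division by [|S* y|]. *)
Lemma rnorm_adjoint (S : {linear H -> H}) (M : R) : 0 <= M ->
  (forall x, rnorm (S x) <= M * rnorm x) ->
  forall y, rnorm (adjoint S y) <= M * rnorm y.
Proof.
move=> M0 S_le y; set z := adjoint S y.
have [z0|z0] := eqVneq (rnorm z) 0; first by rewrite z0 mulr_ge0 ?rnorm_ge0.
have z_gt0 : 0 < rnorm z by rewrite lt_neqAle eq_sym z0 rnorm_ge0.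
rewrite -(ler_pM2r z_gt0) -expr2 sqr_rnorm -(inner_adjoint S_le).
rewrite (le_trans (ler_Re_rnorm _))// (le_trans (cauchy_schwarz _ _))//.
by rewrite mulrAC ler_wpM2r ?rnorm_ge0.
Qed.

(** The bound [M] makes the supremum genuine, since [sup] takes a default value on unbounded
    sets. *)
Lemma opnorm_ge S (M : R) x : 0 <= M ->
  (forall x, rnorm (S x) <= M * rnorm x) -> rnorm x <= 1 ->
  rnorm (S x) <= opnorm S.
Proof.
move=> M0 S_le x1; apply: sup_upper_bound; last by exists x.
split; first by exists (rnorm (S x)); exists x.
exists M => _ [u /= u1 <-]; apply: le_trans (S_le u) _.
by rewrite -[leRHS]mulr1 ler_wpM2l.
Qed.

Lemma opnorm_le S (M : R) :
  (forall x, rnorm x <= 1 -> rnorm (S x) <= M) -> opnorm S <= M.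
Proof.
move=> S_le; apply: ge_sup; last by move=> _ [x /= x1 <-]; exact: S_le.
by exists (rnorm (S 0)); exists 0 => //=; rewrite rnorm0.
Qed.

End Operators.

(** * Row norm and Euclidean radius of a bounded tuple *)

Section Tuples.
Context {R : realType} {H : hilbertType R} {n : nat}.
Variables (T : 'I_n -> {linear H -> H}) (M : 'I_n -> R).
Hypothesis M_ge0 : forall i, 0 <= M i.
Hypothesis T_le : forall i x, rnorm (T i x) <= M i * rnorm x.

Lemma rnorm_row_le x :
  rnorm (\sum_(i < n) T i (adjoint (T i) x)) <= (\sum_(i < n) M i ^+ 2) * rnorm x.
Proof.
rewrite (le_trans (rnorm_sum _ _ _))// mulr_suml ler_sum// => i _.
rewrite expr2 -mulrA (le_trans (T_le _ _))// ler_wpM2l//.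
exact: rnorm_adjoint.
Qed.

Lemma rnorm_row_le_opnorm x : rnorm x <= 1 ->
  rnorm (\sum_(i < n) T i (adjoint (T i) x)) <=
  opnorm (fun x => \sum_(i < n) T i (adjoint (T i) x)).
Proof.
apply: (@opnorm_ge _ _ (fun x => \sum_(i < n) T i (adjoint (T i) x))) rnorm_row_le.
by apply: sumr_ge0 => i _; rewrite sqr_ge0.
Qed.

Lemma row_norm_le : row_norm T <= Num.sqrt (\sum_(i < n) M i ^+ 2).
Proof.
rewrite ler_wsqrtr//; apply: opnorm_le => x x1.
rewrite (le_trans (rnorm_row_le _))// -[leRHS]mulr1 ler_wpM2l//.
by apply: sumr_ge0 => i _; rewrite sqr_ge0.
Qed.

(** [|<T_i h, h>|^2 = |<h, T_i* h>|^2 <= |T_i* h|^2 = <T_i T_i* h, h>]; the sum over [i] is at most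
    the norm of [sum_i T_i T_i* h]. *)
Lemma sum_sqr_inner_le h : rnorm h = 1 ->
  \sum_(i < n) rnorm (inner (T i h) h) ^+ 2 <= row_norm T ^+ 2.
Proof.
move=> h1; have h1' : rnorm h <= 1 by rewrite h1.
rewrite sqr_sqrtr; last by apply: le_trans (rnorm_row_le_opnorm h1'); exact: rnorm_ge0.
apply: le_trans (rnorm_row_le_opnorm h1').
rewrite -[leRHS]mulr1 -h1; apply: le_trans (cauchy_schwarz _ _).
apply: le_trans (ler_Re_rnorm _).
rewrite linear_sumlz /=.
rewrite (big_morph _ (@ReD R) (erefl : complex.Re 0 = 0)); apply: ler_sum => i _.
rewrite !(inner_adjoint (T_le i)) -sqr_rnorm ler_pXn2r ?nnegrE ?rnorm_ge0//.
by rewrite (le_trans (cauchy_schwarz _ _))// h1 mul1r.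
Qed.

Lemma euclidean_radius_le (w : R) : 0 <= w ->
  (forall h, rnorm h = 1 -> \sum_(i < n) rnorm (inner (T i h) h) ^+ 2 <= w ^+ 2) ->
  euclidean_radius T <= w.
Proof.
move=> w0 T_w; rewrite /euclidean_radius; set E := (X in sup X).
(* The trivial space has no unit vector; the supremum of the empty set is 0, whence the hypothesis
   [0 <= w]. *)
have [E0|E0] := pselect (E !=set0).
  apply: ge_sup => // _ [h /= h1 <-].
  by rewrite -(ger0_norm w0) -sqrtr_sqr ler_wsqrtr// T_w.
by rewrite sup_out// => -[].
Qed.

Lemma euclidean_radius_ge h : rnorm h = 1 ->
  Num.sqrt (\sum_(i < n) rnorm (inner (T i h) h) ^+ 2) <= euclidean_radius T.
Proof.
move=> h1; apply: sup_upper_bound; last by exists h.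
split; first by eexists; exists h => //; reflexivity.
exists (row_norm T) => _ [u /= u1 <-].
rewrite -(ger0_norm (sqrtr_ge0 _ : 0 <= row_norm T)) -sqrtr_sqr ler_wsqrtr//.
exact: sum_sqr_inner_le.
Qed.

Lemma euclidean_radius_ge0 : 0 <= euclidean_radius T.
Proof.
rewrite /euclidean_radius; set E := (X in sup X).
have [[_ [h /= h1 _]]|E0] := pselect (E !=set0).
  by apply: le_trans (euclidean_radius_ge h1); exact: sqrtr_ge0.
by rewrite sup_out// => -[].
Qed.

Lemma euclidean_radius_le_row_norm : euclidean_radius T <= row_norm T.
Proof. exact: euclidean_radius_le (sqrtr_ge0 _) sum_sqr_inner_le. Qed.

(** After normalizing [x], the left side is the root of a single term of the sum defining the
    Euclidean radius. *)
Lemma quadratic_form_le i x :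
  rnorm (inner (T i x) x) <= euclidean_radius T * rnorm x ^+ 2.
Proof.
have [->|x0] := eqVneq x 0; first by rewrite linear0r !rnorm0 expr0n mulr0.
have nx : 0 < rnorm x by rewrite rnorm_gt0.
set c := (rnorm x)^-1.
have c0 : 0 < c by rewrite invr_gt0.
have cx1 : rnorm (c%:C *: x) = 1.
  by rewrite rnormZ rnorm_real gtr0_norm// mulVf ?gt_eqF.
have := euclidean_radius_ge cx1.
rewrite -ler_pdivrMr ?exprn_gt0//; apply: le_trans.
have -> : rnorm (inner (T i x) x) / rnorm x ^+ 2 =
    rnorm (inner (T i (c%:C *: x)) (c%:C *: x)).
  rewrite innerZr linearZ innerZl !rnormM rnormJ rnorm_real gtr0_norm//.
  by rewrite mulrA -expr2 exprVn mulrC.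
rewrite -[leLHS]ger0_norm ?rnorm_ge0// -sqrtr_sqr ler_wsqrtr//.
rewrite (bigD1 i)//= lerDl; apply: sumr_ge0 => j _; exact: sqr_ge0.
Qed.

End Tuples.

(** * Polarization *)

Section Polarization.
Context {R : realType} {H : hilbertType R}.
Variables (S : {linear H -> H}) (w : R).
Hypothesis S_w : forall x, rnorm (inner (S x) x) <= w * rnorm x ^+ 2.

(** Polarization writes [4 <S x, y>] with the quadratic form at [x + y], [x - y], [x + i y],
    [x - i y], whose squared norms add up to [4 (|x|^2 + |y|^2)]. *)
Let sesquilinear_le x y :
  rnorm (inner (S x) y) <= w * (rnorm x ^+ 2 + rnorm y ^+ 2).
Proof.
pose Q u := inner (S u) u : R[i].
have QD u v : Q (u + v) = Q u + Q v + inner (S u) v + inner (S v) u.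
  by rewrite /Q linearD innerDl !innerDr; ring.
have SZ (a : R[i]) u v : inner (S (a *: u)) v = a * inner (S u) v.
  by rewrite linearZ innerZl.
have [j [jj cj nj]] : exists j : R[i], [/\ j * j = -1, Num.conj j = - j & rnorm j = 1].
  exists 'i%C; split; first by rewrite -expr2 sqr_i.
    by apply/eqP; rewrite eq_complex /= oppr0 !eqxx.
  by apply: complexI; rewrite rnormE normc_def /= expr0n expr1n add0r sqrtr1.
have polar : 4 * inner (S x) y =
    Q (x + y) - Q (x - y) + j * Q (x + j *: y) - j * Q (x - j *: y).
  have -> : x - y = x + (-1) *: y by rewrite scaleN1r.
  have -> : x - j *: y = x + (- j) *: y by rewrite scaleNr.
  rewrite !QD /Q !SZ !innerZr !rmorphN /= !cj rmorph1.
  (* Grouping the powers of [j] lets [j * j = -1] double the first coefficient and cancel the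
     second. *)
  transitivity ((2 - 2 * (j * j)) * inner (S x) y + (2 + 2 * (j * j)) * inner (S y) x).
    by rewrite jj; ring.
  by ring.
have quad u : rnorm (Q u) <= w * rnorm u ^+ 2 := S_w u.
rewrite -(@ler_pM2l _ 4)//.
have -> : 4 * rnorm (inner (S x) y) = rnorm (4 * inner (S x) y).
  by rewrite rnormM -[4 in RHS](rmorph_nat (real_complex R)) rnorm_real ger0_norm.
rewrite polar.
have := rnormD (Q (x + y) - Q (x - y) + j * Q (x + j *: y)) (- (j * Q (x - j *: y))).
have := rnormD (Q (x + y) - Q (x - y)) (j * Q (x + j *: y)).
have := rnormD (Q (x + y)) (- Q (x - y)).
rewrite !rnormN !rnormM nj !mul1r.
have := quad (x + y); have := quad (x - y).
have := quad (x + j *: y); have := quad (x - j *: y).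
rewrite !sqr_rnormB !sqr_rnormD !rnormZ nj; lra.
Qed.

(** The bound is tested at [y = s S x] with [s = |x| / |S x|], so that [|y| = |x|] and
    [<S x, y> = |x| |S x|]. *)
Lemma rnorm_le_numerical_radius x : rnorm (S x) <= 2 * w * rnorm x.
Proof.
have [Sx0|Sx0] := eqVneq (S x) 0.
  have [->|x0] := eqVneq x 0; first by rewrite linear0 !rnorm0 mulr0.
  (* Here the claim reduces to [0 <= w], which [S_w] at a nonzero vector provides. *)
  have := S_w x; rewrite Sx0 linear0l rnorm0 => h.
  rewrite rnorm0 mulr_ge0 ?rnorm_ge0// mulr_ge0//.
  by rewrite -(pmulr_lge0 _ (_ : 0 < rnorm x ^+ 2)) ?exprn_gt0 ?rnorm_gt0.
have Sx : 0 < rnorm (S x) by rewrite rnorm_gt0.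
have x0 : 0 < rnorm x.
  by rewrite rnorm_gt0; apply: contra_neq Sx0 => ->; rewrite linear0.
set s := rnorm x / rnorm (S x).
have s0 : 0 < s by rewrite divr_gt0.
have := sesquilinear_le x (s%:C *: S x).
have -> : rnorm (s%:C *: S x) = rnorm x.
  by rewrite rnormZ rnorm_real gtr0_norm// divfK ?gt_eqF.
have -> : rnorm (inner (S x) (s%:C *: S x)) = rnorm x * rnorm (S x).
  rewrite innerZr rnormM rnormJ -sqr_rnorm_inner !rnorm_real !ger0_norm ?sqr_ge0 ?ltW//.
  by rewrite expr2 mulrA divfK ?gt_eqF.
by move=> Sx_le; rewrite -(ler_pM2l x0); lra.
Qed.

End Polarization.

Lemma lower_bound (R : realType) (H : hilbertType R) n (T : 'I_n -> {linear H -> H})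
    (M : 'I_n -> R) : (0 < n)%N -> (forall i, 0 <= M i) ->
    (forall i x, rnorm (T i x) <= M i * rnorm x) ->
  1 / (2 * Num.sqrt n%:R) * row_norm T <= euclidean_radius T.
Proof.
move=> n0 M0 T_le; set w := euclidean_radius T.
have w0 : 0 <= w := euclidean_radius_ge0 M0 T_le.
have w_le i x := rnorm_le_numerical_radius (quadratic_form_le M0 T_le i) x.
(* Every [T i] is bounded by [2 w], which gives [row_norm T <= sqrt (n (2 w)^2)]. *)
have := row_norm_le (fun=> mulr_ge0 (ler0n _ 2) w0) w_le.
rewrite (_ : \sum_(i < n) _ = n%:R * (2 * w) ^+ 2); last first.
  by rewrite sumr_const card_ord [RHS]mulr_natl.
rewrite sqrtrM ?ler0n// sqrtr_sqr ger0_norm ?mulr_ge0// => row_le.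
by rewrite mul1r ler_pdivrMl ?mulr_gt0 ?sqrtr_gt0 ?ltr0n// -/w; lra.
Qed.

(** * The joint numerical radius *)

Section JointForm.
Context {R : realType} {H : hilbertType R} {n : nat}.
Variables (T : 'I_n -> {linear H -> H}) (M : 'I_n -> R) (K : R).
Hypothesis T_le : forall i x, rnorm (T i x) <= M i * rnorm x.
Hypotheses (K_gt0 : 0 < K) (M_K : \sum_(i < n) M i ^+ 2 <= K ^+ 2).
Variable h : seq 'I_n -> H.
Hypothesis h1 : (\esum_(a in [set: seq 'I_n]) (rnorm (h a) ^+ 2)%:E = 1)%E.

Let sum_sqr_le1 (s : seq (seq 'I_n)) : uniq s -> \sum_(a <- s) rnorm (h a) ^+ 2 <= 1.
Proof.
move=> us; rewrite -lee_fin -h1 -sumEFin; apply: esum_ge.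
exists [set` s]; first by split; [exact: finite_seq|exact: subsetT].
rewrite -fsbig_seq//.
Qed.

Let f (a : seq 'I_n) : R[i]^o := \sum_(j < n) inner (h a) (T j (h (j :: a))).

(** The weights [1 / K] and [K] are balanced: since [sum_j M_j^2 / K <= K], both parts carry the
    factor [K] after summation over [j]. *)
Let term_le a j : rnorm (inner (h a) (T j (h (j :: a)))) <=
  (M j ^+ 2 / K * rnorm (h a) ^+ 2 + K * rnorm (h (j :: a)) ^+ 2) / 2.
Proof.
apply: le_trans (cauchy_schwarz _ _) _.
apply: le_trans (ler_wpM2l (rnorm_ge0 _) (T_le _ _)) _.
set x := rnorm (h a); set y := rnorm _.
(* AM-GM *)
have : 0 <= (M j * x - K * y) ^+ 2 / K by rewrite divr_ge0 ?sqr_ge0 ?ltW.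
have -> : (M j * x - K * y) ^+ 2 / K =
  M j ^+ 2 / K * x ^+ 2 + K * y ^+ 2 - 2 * (x * (M j * y)).
  by field; rewrite gt_eqF.
by lra.
Qed.

Let partial_sum_le (s : seq (seq 'I_n)) : uniq s -> rnorm (\sum_(a <- s) f a) <= K.
Proof.
move=> us; apply: le_trans (rnorm_sum _ _ _) _.
have f_le a : rnorm (f a) <= (K * rnorm (h a) ^+ 2 +
    K * \sum_(j < n) rnorm (h (j :: a)) ^+ 2) / 2.
  apply: le_trans (rnorm_sum _ _ _) _.
  apply: le_trans (ler_sum _ (fun j _ => term_le a j)) _.
  rewrite -mulr_suml ler_pM2r ?invr_gt0// big_split /= lerD//.
    rewrite -mulr_suml ler_wpM2r ?sqr_ge0// -mulr_suml ler_pdivrMr//.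
  by rewrite mulr_sumr.
apply: le_trans (ler_sum _ (fun a _ => f_le a)) _.
rewrite -mulr_suml ler_pdivrMr// big_split /= -!mulr_sumr -mulrDr ler_pM2l//.
have := sum_sqr_le1 us.
(* The words [j :: a] are pairwise distinct, so their squared norms also sum to at most 1, and the
   total is at most [(K + K) / 2]. *)
have us' : uniq [seq j :: a | a <- s, j <- enum 'I_n].
  by apply: allpairs_uniq => //; [exact: enum_uniq|move=> [a j] [b k] _ _ /= [-> ->]].
have := sum_sqr_le1 us'; rewrite big_allpairs_dep /=.
under eq_bigr do rewrite big_enum /=.
by lra.
Qed.

(** Finite partial sums have modulus at most [K], and when the limit exists some partial sum lies
    within [e] of it. *)
Lemma joint_form_le : rnorm (joint_form T h) <= K.
Proof.
rewrite /joint_form /summability.sum -/f.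
set l := lim _; have [cl|dl] :=
    pselect (cvg (summability.partial_sum f @ summability.totally)); last first.
  (* A divergent lim is the default point, which is 0. *)
  by rewrite /l dvgP// rnorm0 ltW.
apply/ler_addgt0Pr => e e0.
have FF := @summability.totally_filter (seq 'I_n).
have /cvgrPdist_lt /(_ e%:C) := cl; rewrite ltcR => /(_ e0) near_l.
have [A lA] := filter_ex near_l.
rewrite -[l](subrK (summability.partial_sum f A)).
apply: le_trans (rnormD _ _) _; rewrite addrC lerD//.
  rewrite /summability.partial_sum.
  rewrite -(big_seq_fsetE _ A predT f).
  exact: (partial_sum_le (fset_uniq A)).
by rewrite -lecR rnormE ltW.
Qed.

End JointForm.

Lemma joint_radius_le (R : realType) (H : hilbertType R) n (T : 'I_n -> {linear H -> H})
    (M : 'I_n -> R) (K : R) :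
    (forall i x, rnorm (T i x) <= M i * rnorm x) ->
    0 < K -> \sum_(i < n) M i ^+ 2 <= K ^+ 2 ->
  joint_radius T <= K.
Proof.
move=> T_le K0 MK; rewrite /joint_radius; set E := (X in sup X).
have [E0|E0] := pselect (E !=set0).
  by apply: ge_sup => // _ [h /= h1 <-]; move: (joint_form_le T_le K0 MK h1).
by rewrite sup_out ?ltW// => -[].
Qed.

(** * Finitely supported families and words of bounded length *)

Lemma esum_seq (R : realType) (I : choiceType) (s : seq I) (g : I -> R) : uniq s ->
    (forall a, 0 <= g a) -> (forall a, a \notin s -> g a = 0) ->
  (\esum_(a in [set: I]) (g a)%:E = (\sum_(a <- s) g a)%:E)%E.
Proof.
move=> us g0 gs.
rewrite (@eq_esum _ _ _ _ (fun a => if a \in [set` s] then (g a)%:E else 0%E)); last first.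
  by move=> a _; case: ifPn => //; rewrite mem_setE => /gs ->.
rewrite -esum_mkcond esum_fset//; last by move=> a _; rewrite lee_fin.
by rewrite -fsbig_seq// sumEFin.
Qed.

Lemma sum_seq (K : numFieldType) (V : normedModType K) (I : choiceType) (s : seq I)
    (f : I -> V) : uniq s -> (forall a, a \notin s -> f a = 0) ->
  summability.sum f = \sum_(a <- s) f a.
Proof.
move=> us fs; have FF := @summability.totally_filter I.
apply: cvg_lim => //; apply: cvg_near_cst.
(* The partial sums are constant on all finite sets containing [s]. *)
exists [fset a in s]%fset => //= A /= sA; rewrite /summability.partial_sum.
rewrite -(big_seq_fsetE _ A predT f) -(big_fset_incl _ sA) /=.
  by apply: perm_big; apply: uniq_perm => // a; rewrite inE.
by move=> a _; rewrite inE => /fs.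
Qed.

Fixpoint words n k : seq (seq 'I_n) :=
  if k is k'.+1 then [seq j :: a | a <- words n k', j <- enum 'I_n] else [:: [::]].

Lemma mem_words n k a : (a \in words n k) = (size a == k).
Proof.
elim: k a => [|k IH] [|j a] //=.
  by apply/allpairsP => -[[b i] [_ _]].
rewrite eqSS -IH; apply/allpairsP/idP => [[[b i] [/= b_in _ [_ ->]]]//|a_in].
by exists (a, j); rewrite mem_enum.
Qed.

Lemma words_uniq n k : uniq (words n k).
Proof.
elim: k => //= k IH; apply: allpairs_uniq => //; first exact: enum_uniq.
by move=> [a j] [b i] _ _ /= [-> ->].
Qed.

(** The sum expands [(sum_j p j)^k]; weights summing to 1 on the letters induce such weights on the
    words of each length. *)
Lemma sum_prod_words (R : comNzRingType) n (p : 'I_n -> R) k : \sum_(j < n) p j = 1 ->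
  \sum_(a <- words n k) \prod_(j <- a) p j = 1.
Proof.
move=> p1; elim: k => [|k IH] /=; first by rewrite big_seq1 big_nil.
rewrite big_allpairs_dep /= -[RHS]IH; apply: eq_bigr => a _.
rewrite big_enum /= -[RHS]mul1r -p1 mulr_suml; apply: eq_bigr => j _.
by rewrite big_cons.
Qed.

Fixpoint short_words n N : seq (seq 'I_n) :=
  if N is N'.+1 then short_words n N' ++ words n N' else [::].

Lemma mem_short_words n N a : (a \in short_words n N) = (size a < N)%N.
Proof. by elim: N => //= N IH; rewrite mem_cat IH mem_words ltnS orbC [RHS]leq_eqVlt. Qed.

Lemma short_words_uniq n N : uniq (short_words n N).
Proof.
elim: N => //= N IH; rewrite cat_uniq IH words_uniq andbT /=.
by apply/hasPn => a; rewrite mem_words mem_short_words => /eqP ->; rewrite ltnn.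
Qed.

Lemma sum_prod_short_words (R : comNzRingType) n (p : 'I_n -> R) N :
  \sum_(j < n) p j = 1 -> \sum_(a <- short_words n N) \prod_(j <- a) p j = N%:R.
Proof.
move=> p1; elim: N => [|N IH] /=; first by rewrite big_nil.
by rewrite big_cat /= IH sum_prod_words// natr1.
Qed.

(** * The geometric test family for the joint numerical radius *)

Section GeometricFamily.
Context {R : realType} {H : hilbertType R} {n : nat}.
Variables (T : 'I_n -> {linear H -> H}) (h0 : H).
Hypothesis h0_unit : rnorm h0 = 1.

Let r := Num.sqrt (\sum_(i < n) rnorm (inner (T i h0) h0) ^+ 2).
Hypothesis r_gt0 : 0 < r.

Let c j : R[i] := inner h0 (T j h0).
Let lambda j : R[i] := r^-1%:C * c j.

Let sum_sqr_c : \sum_(j < n) rnorm (c j) ^+ 2 = r ^+ 2.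
Proof.
rewrite sqr_sqrtr; last by apply: sumr_ge0 => j _; exact: sqr_ge0.
by apply: eq_bigr => j _; rewrite /c innerC rnormJ.
Qed.

Let sum_sqr_lambda : \sum_(j < n) rnorm (lambda j) ^+ 2 = 1.
Proof.
under eq_bigr do rewrite rnormM exprMn rnorm_real real_normK ?num_real//.
by rewrite -mulr_sumr sum_sqr_c -exprMn mulVf ?gt_eqF// expr1n.
Qed.

(** Equality case of Cauchy-Schwarz: [lambda] is the unit vector of coefficients proportional to
    [c], and [r] is the length of [c]. *)
Let conj_lambda_c : \sum_(j < n) Num.conj (lambda j) * c j = r%:C.
Proof.
transitivity (\sum_(j < n) (r^-1 * rnorm (c j) ^+ 2)%:C).
  apply: eq_bigr => j _; rewrite rmorphM /= conj_realC [RHS]rmorphM /= sqr_rnormC.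
  by rewrite [c j * _]mulrC mulrA.
by rewrite -rmorph_sum /= -mulr_sumr sum_sqr_c expr2 mulrA mulVf ?gt_eqF// mul1r.
Qed.

Variable N : nat.
Let s : R := Num.sqrt N.+1%:R^-1.
Let mu (a : seq 'I_n) : R[i] := \prod_(j <- a) lambda j.
Let h (a : seq 'I_n) : H := if (size a <= N)%N then (s%:C * mu a) *: h0 else 0.

Let sqr_s : s ^+ 2 = N.+1%:R^-1.
Proof. by rewrite sqr_sqrtr// invr_ge0. Qed.

Let sqr_mu a : rnorm (mu a) ^+ 2 = \prod_(j <- a) rnorm (lambda j) ^+ 2.
Proof.
rewrite /mu; elim: a => [|j a IH].
  by rewrite !big_nil -(rmorph1 (real_complex R)) rnorm_real normr1 expr1n.
by rewrite !big_cons rnormM exprMn IH.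
Qed.

(** Each of the [N + 1] lengths [0, ..., N] contributes [s^2 = 1 / (N + 1)]. *)
Lemma geometric_family_unit : (\esum_(a in [set: seq 'I_n]) (rnorm (h a) ^+ 2)%:E = 1)%E.
Proof.
rewrite (esum_seq (short_words_uniq n N.+1)) => [|a|a]; last 2 first.
- exact: sqr_ge0.
- by rewrite mem_short_words ltnS /h => /negPf ->; rewrite rnorm0 expr0n.
congr (_%:E); rewrite big_seq.
under eq_bigr => a.
  rewrite mem_short_words ltnS /h => ->.
  rewrite rnormZ h0_unit mulr1 rnormM exprMn rnorm_real real_normK ?num_real// sqr_s sqr_mu.
  over.
by rewrite -big_seq -mulr_sumr sum_prod_short_words// mulVf.
Qed.

Lemma joint_form_geometric : joint_form T h = (N%:R / N.+1%:R * r)%:C.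
Proof.
(* Only lengths below [N] contribute: at length [N] the word [j :: a] already leaves the support.
   Hence [N] lengths here against [N + 1] in the normalization. *)
rewrite /joint_form (sum_seq (short_words_uniq n N)) => [|a]; last first.
  rewrite mem_short_words -leqNgt => aN; apply: big1 => j _.
  by rewrite [h (_ :: _)]/h /= ltnNge aN linear0 linear0r.
(* Conjugation in the second argument turns the term at [a] and [j] into [s^2 |mu a|^2] times
   [conj (lambda j) * c j]. *)
transitivity (\sum_(a <- short_words n N)
    (N.+1%:R^-1 * (\prod_(j <- a) rnorm (lambda j) ^+ 2) * r)%:C).
  rewrite big_seq [RHS]big_seq; apply: eq_bigr => a.
  rewrite mem_short_words => aN.
  rewrite rmorphM /= -conj_lambda_c mulr_sumr; apply: eq_bigr => j _.
  rewrite /h /= ltnW// aN linearZ /= innerZr innerZl -/(c j) /mu big_cons -/(mu a).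
  rewrite -sqr_mu -sqr_s [(s ^+ 2 * _)%:C]rmorphM /= sqr_rnormC [(s ^+ 2)%:C]rmorphXn /=.
  rewrite !rmorphM /= conj_realC; ring.
rewrite -rmorph_sum /= -mulr_suml -mulr_sumr sum_prod_short_words//.
by rewrite [_^-1 * _]mulrC.
Qed.

End GeometricFamily.

Lemma euclidean_radius_le_joint_radius (R : realType) (H : hilbertType R) n
    (T : 'I_n -> {linear H -> H}) (M : 'I_n -> R) :
    (forall i x, rnorm (T i x) <= M i * rnorm x) ->
  euclidean_radius T <= joint_radius T.
Proof.
(* Adding 1 keeps [K] positive even if all [M i] vanish; [K] bounds the set whose supremum is the
   joint radius. *)
move=> T_le; pose K := Num.sqrt (\sum_(i < n) M i ^+ 2) + 1.
have K0 : 0 < K by rewrite ltr_wpDl ?sqrtr_ge0.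
have MK : \sum_(i < n) M i ^+ 2 <= K ^+ 2.
  rewrite -[leLHS]sqr_sqrtr; last by apply: sumr_ge0 => i _; exact: sqr_ge0.
  by rewrite ler_pXn2r ?nnegrE ?sqrtr_ge0 ?(ltW K0)// lerDl.
have joint_ge h : (\esum_(a in [set: seq 'I_n]) (rnorm (h a) ^+ 2)%:E = 1)%E ->
    rnorm (joint_form T h) <= joint_radius T.
  move=> h1; apply: sup_upper_bound; last by exists h.
  split; first by exists (rnorm (joint_form T h)); exists h.
  by exists K => _ [g /= g1 <-]; move: (joint_form_le T_le K0 MK g1).
have joint_ge0 : 0 <= joint_radius T.
  rewrite /joint_radius; set E := (X in sup X).
  have [[_ [h /= h1 _]]|E0] := pselect (E !=set0).
    by apply: le_trans (joint_ge _ h1); exact: rnorm_ge0.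
  by rewrite sup_out// => -[].
have r_le h0 : rnorm h0 = 1 ->
    Num.sqrt (\sum_(i < n) rnorm (inner (T i h0) h0) ^+ 2) <= joint_radius T.
  move=> h01; set r := Num.sqrt _.
  (* The test family divides by [r], so [r = 0] is settled by nonnegativity. *)
  have [r0|r0] := lerP r 0; first exact: le_trans r0 joint_ge0.
  apply/ler_addgt0Pr => e e0.
  (* The family loses [r / (N + 1)], which is below [e] once [1 / (N + 1) < e / r]. *)
  have er : 0 < e / r by rewrite divr_gt0.
  have [N Ne] := filter_ex (near_infty_natSinv_lt (PosNum er)).
  have := joint_ge _ (geometric_family_unit h01 r0 N).
  rewrite joint_form_geometric// rnorm_real ger0_norm; last first.
    by rewrite mulr_ge0 ?(ltW r0)// divr_ge0.
  have -> : N%:R / N.+1%:R * r = r - N.+1%:R^-1 * r.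
    by rewrite -natr1; field; rewrite natr1.
  by move: Ne => /=; rewrite ltr_pdivlMr//; move: (_^-1 * r) => q; lra.
apply: euclidean_radius_le => // h0 h01.
by rewrite -ler_sqrt ?sqr_ge0// sqrtr_sqr ger0_norm// r_le.
Qed.

(** * Unitary spaces *)

(* An alias, because the canonical norm on row vectors is the sup norm. *)
Definition unitary_space (R : realType) (m : nat) : Type := 'rV[R[i]]_m.

Section UnitarySpace.
Context {R : realType} {m : nat}.
Notation E := (unitary_space R m).

HB.instance Definition _ := Vector.copy E 'rV[R[i]]_m.

Definition unitary_dot (x y : E) : R[i] := \sum_(j < m) x 0 j * Num.conj (y 0 j).

Let unitary_dot_bilinear :
  bilinear_for (GRing.Scale.Law.clone _ _ *%R _)
    (GRing.Scale.Law.clone _ _ (Num.conj \; *%R) _) unitary_dot.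
Proof.
split=> [y a x x'|x a y y'] /=; rewrite /unitary_dot mulr_sumr -big_split /=.
  by apply: eq_bigr => j _; rewrite !mxE mulrDl mulrA.
by apply: eq_bigr => j _; rewrite !mxE rmorphD rmorphM mulrDr mulrCA.
Qed.

HB.instance Definition _ :=
  bilinear_isBilinear.Build R[i] E E R[i] _ _ unitary_dot unitary_dot_bilinear.

Let unitary_dot_hermitian x y :
  unitary_dot x y = (-1) ^+ false * Num.conj (unitary_dot y x).
Proof.
rewrite expr0 mul1r /unitary_dot rmorph_sum; apply: eq_bigr => j _.
by rewrite rmorphM /= conjCK mulrC.
Qed.

HB.instance Definition _ :=
  isHermitianSesquilinear.Build R[i] E false Num.conj unitary_dot
    unitary_dot_hermitian.

Lemma unitary_dot_sqr x : unitary_dot x x = \sum_(j < m) `|x 0 j| ^+ 2.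
Proof. by apply: eq_bigr => j _; rewrite normCK. Qed.

Let unitary_dot_gt0 (x : E) : x != 0 -> 0 < unitary_dot x x.
Proof.
move=> x0; rewrite unitary_dot_sqr lt_neqAle; apply/andP; split; last first.
  by apply: sumr_ge0 => j _; exact: exprn_ge0.
apply: contra_neq x0 => /esym/eqP.
rewrite psumr_eq0 => [/allP xj0|j _]; last exact: exprn_ge0.
apply/rowP => j; have := xj0 j (mem_index_enum _).
by rewrite mxE sqrf_eq0 normr_eq0 => /eqP.
Qed.

HB.instance Definition _ :=
  isDotProduct.Build R[i] E unitary_dot unitary_dot_gt0.

Let norm (x : E) : R[i] := sqrtC (unitary_dot x x).

Let ler_normD x y : norm (x + y) <= norm x + norm y.
Proof. exact: (triangle_lerif unitary_dot x y). Qed.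

Let normrZ (a : R[i]) x : norm (a *: x) = `|a| * norm x.
Proof.
rewrite /norm (dnormZ unitary_dot) sqrtCM ?nnegrE ?exprn_ge0// ?sqrCK//.
Qed.

Let normr0_eq0 x : norm x = 0 -> x = 0.
Proof. by move/eqP; rewrite (sqrt_dnorm_eq0 unitary_dot) => /eqP. Qed.

HB.instance Definition _ := Lmodule_isNormed.Build R[i] E ler_normD normrZ normr0_eq0.

Lemma sqr_unitary_norm (x : E) : `|x| ^+ 2 = unitary_dot x x.
Proof. exact: sqrtCK. Qed.

Lemma unitary_norm_sum (x : E) : rnorm x ^+ 2 = \sum_(j < m) rnorm (x 0 j) ^+ 2.
Proof.
apply: complexI; rewrite rmorphXn /= rnormE sqr_unitary_norm unitary_dot_sqr.
by rewrite rmorph_sum; apply: eq_bigr => j _; rewrite rmorphXn /= rnormE.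
Qed.

Lemma unitary_coord_le (x : E) j : rnorm (x 0 j) <= rnorm x.
Proof.
rewrite -(@ler_pXn2r _ 2) ?nnegrE ?rnorm_ge0// unitary_norm_sum (bigD1 j)//= lerDl.
by apply: sumr_ge0 => k _; exact: sqr_ge0.
Qed.

(** A 1-Lipschitz real function sends a Cauchy filter to a Cauchy filter, which converges in [R];
    applied to real and imaginary parts of coordinates. *)
Let complete_coord (F : set_system E) (g : E -> R) :
  ProperFilter F -> cauchy F ->
  (forall x y, `|g x - g y| <= rnorm (x - y)) -> cvg (g @ F).
Proof.
move=> FF /cauchyP Fc g_lip; apply: cauchy_cvg; apply/cauchy_exP => e e0.
have eC0 : 0 < e%:C by rewrite ltcR.
have [x Fx] := Fc _ eC0.
exists (g x); suff : F (g @^-1` ball (g x) e) by [].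
apply: filterS _ Fx => y; rewrite -!ball_normE /= => xy.
apply: le_lt_trans (g_lip x y) _.
by rewrite -ltcR rnormE.
Qed.

Let unitary_complete (F : set_system E) : ProperFilter F -> cauchy F -> cvg F.
Proof.
move=> FF Fc.
have Re_cvg j : cvg ((fun x : E => complex.Re (x 0 j)) @ F).
  apply: complete_coord => // x y; apply: le_trans (unitary_coord_le (x - y) j).
  by rewrite !mxE -lecR rnormE -ReN -ReD normc_ge_Re.
have Im_cvg j : cvg ((fun x : E => complex.Im (x 0 j)) @ F).
  apply: complete_coord => // x y; apply: le_trans (unitary_coord_le (x - y) j).
  by rewrite !mxE -ImN -ImD ler_normIm.
pose z : E := \row_j (lim ((fun x : E => complex.Re (x 0 j)) @ F) +i*
                      lim ((fun x : E => complex.Im (x 0 j)) @ F)).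
apply/cvg_ex; exists z; apply/cvg_ballP => e e0.
have [eE e0'] : e = (complex.Re e)%:C /\ 0 < complex.Re e.
  by have := gtr0_real e0 => /RRe_real eE; rewrite -ltcR eE.
(* Real and imaginary parts each receive [q / 2]. Dividing by [m + 1] makes the total [m q] strictly
   less than [r^2] and covers [m = 0]. *)
set r := complex.Re e in eE e0'; set q := r ^+ 2 / m.+1%:R.
have q0 : 0 < q by rewrite divr_gt0 ?exprn_gt0.
have d0 : 0 < Num.sqrt (q / 2) by rewrite sqrtr_gt0 divr_gt0.
have near_Re : \forall x \near F, forall j : 'I_m,
    `|complex.Re (z 0 j) - complex.Re ((x : E) 0 j)| < Num.sqrt (q / 2).
  by apply: filter_forall => j; rewrite mxE; move/cvgrPdist_lt : (Re_cvg j); apply.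
have near_Im : \forall x \near F, forall j : 'I_m,
    `|complex.Im (z 0 j) - complex.Im ((x : E) 0 j)| < Num.sqrt (q / 2).
  by apply: filter_forall => j; rewrite mxE; move/cvgrPdist_lt : (Im_cvg j); apply.
apply: filterS2 near_Re near_Im => x xRe xIm.
rewrite -ball_normE /= eE -rnormE ltcR -(@ltr_pXn2r _ 2)// ?nnegrE ?rnorm_ge0 ?ltW//.
have sqr_lt (a b : R) : `|a - b| < Num.sqrt (q / 2) -> (a - b) ^+ 2 <= q / 2.
  move=> ab; rewrite -[leRHS]sqr_sqrtr; last by rewrite ltW// divr_gt0.
  by rewrite -real_normK ?num_real// ler_pXn2r ?nnegrE ?sqrtr_ge0// ltW.
have coord_lt j : rnorm ((z - x) 0 j) ^+ 2 <= q.
  rewrite mxE [(- x) 0 j]mxE sqr_rnormE ReD ReN ImD ImN /=.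
  have -> : q = q / 2 + q / 2 by lra.
  by apply: lerD; apply: sqr_lt; [exact: xRe|exact: xIm].
rewrite unitary_norm_sum; apply: le_lt_trans (ler_sum _ (fun j _ => coord_lt j)) _.
rewrite sumr_const card_ord -mulr_natl /q mulrCA gtr_pMr ?exprn_gt0//.
by rewrite ltr_pdivrMr// mul1r ltr_nat.
Qed.

HB.instance Definition _ := Uniform_isComplete.Build E unitary_complete.
HB.instance Definition _ :=
  CompleteNormedModule_isHilbert.Build R E sqr_unitary_norm.

End UnitarySpace.

(** * Extremal tuples *)

Section Examples.
Context {R : realType} {n : nat}.
Notation E := (unitary_space R n.+1).

Definition unit_vector (k : 'I_n.+1) : E := delta_mx 0 k.

Lemma inner_unit_vector (x : E) k : inner x (unit_vector k) = x 0 k.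
Proof.
rewrite [LHS](bigD1 k)//= big1 => [|j jk]; first by rewrite mxE !eqxx rmorph1 mulr1 addr0.
by rewrite mxE eqxx (negPf jk) rmorph0 mulr0.
Qed.

Lemma rnorm_unit_vector k : rnorm (unit_vector k) = 1.
Proof.
apply/eqP; rewrite -(@eqrXn2 _ 2) ?rnorm_ge0// sqr_rnorm inner_unit_vector.
by rewrite mxE !eqxx expr1n.
Qed.

Definition rank1_op (i : 'I_n) (x : E) : E := x 0 (lift ord0 i) *: unit_vector ord0.

Let rank1_op_linear i : linear (rank1_op i).
Proof. by move=> a x y; rewrite /rank1_op !mxE scalerDl scalerA. Qed.

HB.instance Definition _ i :=
  GRing.isLinear.Build R[i] E E *:%R (rank1_op i) (rank1_op_linear i).

Lemma rnorm_rank1_op_le i x : rnorm (rank1_op i x) <= 1 * rnorm x.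
Proof. by rewrite rnormZ rnorm_unit_vector mulr1 mul1r unitary_coord_le. Qed.

Let rank1_T : 'I_n -> {linear E -> E} := fun i => rank1_op i.

Lemma euclidean_radius_rank1 : euclidean_radius rank1_T <= 1 / 2.
Proof.
apply: euclidean_radius_le; first by rewrite divr_ge0.
move=> h h1; have := unitary_norm_sum h.
(* With [p = |h_0|^2] and [q] the weight of the other coordinates, [p + q = 1] and the form is
   [p q <= 1/4]. *)
rewrite h1 big_ord_recl; set p := rnorm (h 0 ord0) ^+ 2; set q := (X in p + X) => pq.
have -> : \sum_(i < n) rnorm (inner (rank1_T i h) h) ^+ 2 = q * p.
  rewrite mulr_suml; apply: eq_bigr => i _.
  by rewrite innerZl innerC inner_unit_vector rnormM rnormJ exprMn.
have {pq} -> : q = 1 - p by move: pq; lra.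
by have := sqr_ge0 (p - 1 / 2); lra.
Qed.

(** [T_i* e_0 = e_i] and [T_i e_i = e_0], so [sum_i T_i T_i*] maps the unit vector [e_0] to
    [n e_0]. *)
Lemma row_norm_rank1 : Num.sqrt n%:R <= row_norm rank1_T.
Proof.
rewrite ler_wsqrtr//.
have adj i : adjoint (rank1_T i) (unit_vector ord0) = unit_vector (lift ord0 i).
  apply: adjoint_eq => x.
  by rewrite innerZl !inner_unit_vector mxE !eqxx mulr1.
have e1 : rnorm (unit_vector ord0) <= 1 by rewrite rnorm_unit_vector.
apply: le_trans (rnorm_row_le_opnorm (fun=> ler01) rnorm_rank1_op_le e1).
under eq_bigr do rewrite adj /= /rank1_op mxE !eqxx scale1r.
rewrite sumr_const card_ord.
have -> : unit_vector ord0 *+ n = (n%:R%:C : R[i]) *: unit_vector ord0.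
  by rewrite rmorph_nat scaler_nat.
by rewrite rnormZ rnorm_unit_vector mulr1 rnorm_real ger0_norm.
Qed.

Variable i0 : 'I_n.

Definition single_id (i : 'I_n) : {linear E -> E} :=
  if i == i0 then (idfun : {linear E -> E}) else (\0 : {linear E -> E}).

Lemma rnorm_single_id_le i x : rnorm (single_id i x) <= (i == i0)%:R * rnorm x.
Proof. by rewrite /single_id; case: eqP => _ /=; rewrite ?mul1r// mul0r rnorm0. Qed.

Lemma sum_single_id : \sum_(i < n) (i == i0)%:R ^+ 2 = 1 :> R.
Proof.
rewrite (bigD1 i0)//= eqxx expr1n big1 ?addr0// => i /negPf ->.
by rewrite expr0n.
Qed.

Lemma euclidean_radius_single_id : 1 <= euclidean_radius single_id.
Proof.
apply: le_trans (euclidean_radius_ge (fun i => ler0n R (i == i0)) rnorm_single_id_le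
  (rnorm_unit_vector ord0)).
rewrite -[leLHS]sqrtr1 ler_wsqrtr// (bigD1 i0)//= /single_id eqxx /= inner_unit_vector.
rewrite mxE !eqxx -(rmorph1 (real_complex R)) rnorm_real normr1 expr1n lerDl.
by apply: sumr_ge0 => i _; exact: sqr_ge0.
Qed.

Lemma joint_radius_single_id : joint_radius single_id <= 1.
Proof. by apply: joint_radius_le rnorm_single_id_le _ _ => //; rewrite sum_single_id expr1n. Qed.

Lemma row_norm_single_id : row_norm single_id <= 1.
Proof.
have := row_norm_le (fun i => ler0n R (i == i0)) rnorm_single_id_le.
by rewrite sum_single_id sqrtr1.
Qed.

End Examples.

(** Common end of both arguments for the constant 1: [u] is a Euclidean radius, [v] a joint radius
    or a row norm. *)
Lemma ge1_of_ratio (R : realDomainType) (c u v : R) :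
  0 <= v <= 1 -> 1 <= u -> u <= c * v -> 1 <= c.
Proof.
case/andP => v0 v1 u1 ucv; have [//|c1] := lerP 1 c.
have [v00|v_gt0] := eqVneq v 0; first by move: ucv; rewrite v00; lra.
have : c * v < 1 * v by rewrite ltr_pM2r// lt_neqAle eq_sym v_gt0.
lra.
Qed.

Theorem proposition2p4 (R : realType) (n : nat) (n_gt0 : (0 < n)%N) :
  (forall (H : hilbertType R) (T : 'I_n -> {linear H -> H}),
     (forall i, bounded_operator (T i)) ->
     [/\ euclidean_radius T <= joint_radius T,
         1 / (2 * Num.sqrt n%:R) * row_norm T <= euclidean_radius T &
         euclidean_radius T <= row_norm T])
  /\
  [/\ forall c : R,
        (forall (H : hilbertType R) (T : 'I_n -> {linear H -> H}),
           (forall i, bounded_operator (T i)) ->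
           euclidean_radius T <= c * joint_radius T) ->
        1 <= c,
      forall c : R,
        (forall (H : hilbertType R) (T : 'I_n -> {linear H -> H}),
           (forall i, bounded_operator (T i)) ->
           c * row_norm T <= euclidean_radius T) ->
        c <= 1 / (2 * Num.sqrt n%:R) &
      forall c : R,
        (forall (H : hilbertType R) (T : 'I_n -> {linear H -> H}),
           (forall i, bounded_operator (T i)) ->
           euclidean_radius T <= c * row_norm T) ->
        1 <= c].
Proof.
split=> [H T T_bounded|].
  (* Bounds for the operators are chosen at once, then replaced by their absolute values to be
     nonnegative. *)
  have [M T_le] := choice T_bounded.
  have T_le' i x : rnorm (T i x) <= `|M i| * rnorm x.
    by apply: le_trans (T_le i x) _; rewrite ler_wpM2r ?rnorm_ge0// ler_norm.
  have M_ge0 i : 0 <= `|M i| by [].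
  split.
  - exact: euclidean_radius_le_joint_radius T_le.
  - exact: lower_bound n_gt0 M_ge0 T_le'.
  - exact: euclidean_radius_le_row_norm M_ge0 T_le'.
pose i0 := Ordinal n_gt0.
have id_bounded i : bounded_operator (single_id (R := R) i0 i).
  by exists (i == i0)%:R; exact: rnorm_single_id_le.
have id_euclid := euclidean_radius_single_id (R := R) i0.
split=> c c_bound.
- apply: (ge1_of_ratio _ id_euclid (c_bound _ _ id_bounded)).
  rewrite joint_radius_single_id andbT (le_trans ler01)// (le_trans id_euclid)//.
  exact: euclidean_radius_le_joint_radius (rnorm_single_id_le i0).
(* A nonpositive [c] is trivially small enough; for [c > 0] the rank-one tuple gives
   [c sqrt n <= c row_norm <= 1/2]. *)
- have [c0|c0] := lerP c 0; first by rewrite (le_trans c0)// divr_ge0// mulr_ge0.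
  rewrite ler_pdivlMr ?mulr_gt0 ?sqrtr_gt0 ?ltr0n//.
  have rank1_bounded i : bounded_operator (@rank1_op R n i).
    by exists 1; exact: rnorm_rank1_op_le.
  have := le_trans (c_bound _ _ rank1_bounded) euclidean_radius_rank1.
  have := ler_wpM2l (ltW c0) (@row_norm_rank1 R n); lra.
- apply: (ge1_of_ratio _ id_euclid (c_bound _ _ id_bounded)).
  by rewrite row_norm_single_id sqrtr_ge0.
Qed.
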